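(* Let $W^L$ be a state with specific volume $v^L$ and hydrodynamical pressure $p_{\mathrm h}^L$, and let $p_{\mathrm h}^*\ge p_{\mathrm h}^L$ be fixed. Let $v^*<v^L$ be given by the Rankine–Hugoniot condition $$\hat e_{\mathrm h}(v^*,p_{\mathrm h}^* )-\hat e_{\mathrm h}(v^L,p_{\mathrm h}^L)+\tfrac12(p_{\mathrm h}^*+p_{\mathrm h}^L)(v^*-v^L)+\hat A_{\mathrm b}(v^*,v^L)=0,$$ and let $\tilde v^*$ satisfy $$\hat e_{\mathrm h}(\tilde v^*,p_{\mathrm h}^* )-\hat e_{\mathrm h}(v^L,p_{\mathrm h}^L)+\tfrac12(p_{\mathrm h}^*+p_{\mathrm h}^L)(\tilde v^*-v^L)=0.$$ Then $\tilde v^*\ge v^*$ if $\hat A_{\mathrm b}(v^*,v^L)\ge0$, and $\tilde v^*\le v^*$ if $\hat A_{\mathrm b}(v^*,v^L)\le0$. Furthermore, $$\frac{v^L-\tilde v^*}{v^L-v^*}\;\le\;\begin{cases}1&\text{if }\hat A_{\mathrm b}(v^*,v^L)\ge0,\\[0.3em] 1+\dfrac{\hat p_{\mathrm b}(v^* )-\hat p_{\mathrm b}(v^L)}{p_{\mathrm h}^*-p_{\mathrm h}^L}&\text{if }\hat A_{\mathrm b}(v^*,v^L)\le0\text{ and }p_{\mathrm h}^*>p_{\mathrm h}^L.\end{cases}$$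
   Context: $v=1/\rho$ is the specific volume; a hat marks a quantity expressed as a function of $v$. The total pressure is $p=p_{\mathrm h}+p_{\mathrm b}(\rho)$; $p_{\mathrm h}$ is a complete equation of state with specific internal energy $e_{\mathrm h}$, specific entropy $s_{\mathrm h}$ and sound speed $a_{\mathrm h}$; $p_{\mathrm b}(\rho)=\rho^2\partial_\rho e_{\mathrm b}(\rho)$, i.e. $\hat e_{\mathrm b}'(v)=-\hat p_{\mathrm b}(v)$. $\hat e_{\mathrm h}(v,p_{\mathrm h})$ is $e_{\mathrm h}$ as a function of $v$ and $p_{\mathrm h}$. Standing assumptions (constants $p_\infty,q\in\mathbb R$): $p_{\mathrm h}>-p_\infty$, $a_{\mathrm h}^2=-v^2\partial_v\hat p_{\mathrm h}|_{s_{\mathrm h}}>0$, $\partial_v^2\hat p_{\mathrm h}|_{s_{\mathrm h}}>0$; $\partial_v\hat e_{\mathrm h}|_{p_{\mathrm h}}\ge p_\infty$, $\partial_{p_{\mathrm h}}\hat e_{\mathrm h}|_v\ge0$, $\partial_{s_{\mathrm h}}\hat p_{\mathrm h}|_v>0$, $\hat e_{\mathrm h}\ge q$, $\lim_{v\to0+}\hat e_{\mathrm h}(v,p_{\mathrm h})=q$; $e_{\mathrm b}$ is $C^3$ and $a_{\mathrm b}^2(\rho)=\partial_\rho p_{\mathrm b}(\rho)\ge0$ (so $\hat p_{\mathrm b}$ is non-increasing in $v$). Moreover $\hat A_{\mathrm b}(v^*,v):=\hat e_{\mathrm b}(v^* )-\hat e_{\mathrm b}(v)+\tfrac12(\hat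 p_{\mathrm b}(v^* )+\hat p_{\mathrm b}(v))(v^*-v)$. *)

(* Defs.v *)
From Stdlib Require Import Reals.
From Coquelicot Require Import Coquelicot.
Open Scope R_scope.

(** Pressure [- d e / d v] at fixed entropy, for an energy [e v s] given as a
    function of specific volume and specific entropy. *)
Definition pressure (e : R -> R -> R) (v s : R) : R :=
  - Derive (fun w => e w s) v.

(** A complete equation of state is given by its fundamental relation, the
    internal energy as a function of (specific volume, specific entropy).
    The pairs (v, s) in [h_dom] are the thermodynamic states; the set of
    entropies attained may depend on the gas and on v.  In the variables
    (v, p_h) the states form the whole quadrant v > 0, p_h > - pinf, and [s_h]
    is the entropy in these variables. *)
Record complete_eos (pinf : R) : Type := CompleteEos {
  h_dom : R -> R -> Prop;
  e_vs : R -> R -> R;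
  s_h : R -> R -> R;
  h_dom_open : open (fun x : R * R => h_dom (fst x) (snd x));
  h_dom_volume : forall v s, h_dom v s -> 0 < v;
  e_vs_derivable_v : forall v s, h_dom v s -> ex_derive (fun w => e_vs w s) v;
  e_vs_derivable_s : forall v s, h_dom v s -> ex_derive (fun t => e_vs v t) s;
  h_dom_pressure : forall v s, h_dom v s -> - pinf < pressure e_vs v s;
  s_h_dom : forall v p, 0 < v -> - pinf < p -> h_dom v (s_h v p);
  pressure_s_h : forall v p, 0 < v -> - pinf < p ->
    pressure e_vs v (s_h v p) = p;
  s_h_pressure : forall v s, h_dom v s -> s_h v (pressure e_vs v s) = s
}.

Arguments h_dom {pinf} _ _ _.
Arguments e_vs {pinf} _ _ _.
Arguments s_h {pinf} _ _ _.

Definition p_vs {pinf : R} (H : complete_eos pinf) (v s : R) : R :=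
  pressure (e_vs H) v s.

Definition a_h_sq {pinf : R} (H : complete_eos pinf) (v s : R) : R :=
  - v ^ 2 * Derive (fun w => p_vs H w s) v.

(** The energy as a function of (v, p_h). *)
Definition e_h {pinf : R} (H : complete_eos pinf) (v p : R) : R :=
  e_vs H v (s_h H v p).

(** [Derive] is total, so each condition on a derivative is paired with its
    existence. *)
Record hydro_assumptions {pinf : R} (q : R) (H : complete_eos pinf) : Prop :=
  HydroAssumptions {
  a_h_sq_pos : forall v s, h_dom H v s ->
    ex_derive (fun w => p_vs H w s) v /\ 0 < a_h_sq H v s;
  p_vs_convex : forall v s, h_dom H v s ->
    ex_derive_n (fun w => p_vs H w s) 2 v /\
    0 < Derive_n (fun w => p_vs H w s) 2 v;
  e_h_dv : forall v p, 0 < v -> - pinf < p ->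
    ex_derive (fun w => e_h H w p) v /\ pinf <= Derive (fun w => e_h H w p) v;
  e_h_dp : forall v p, 0 < v -> - pinf < p ->
    ex_derive (fun r => e_h H v r) p /\ 0 <= Derive (fun r => e_h H v r) p;
  p_vs_ds : forall v s, h_dom H v s ->
    ex_derive (fun t => p_vs H v t) s /\ 0 < Derive (fun t => p_vs H v t) s;
  e_h_ge : forall v p, 0 < v -> - pinf < p -> q <= e_h H v p;
  e_h_lim : forall p, - pinf < p ->
    filterlim (fun v => e_h H v p) (at_right 0) (locally q)
}.

Definition p_b (e_b : R -> R) (rho : R) : R := rho ^ 2 * Derive e_b rho.

Definition a_b_sq (e_b : R -> R) (rho : R) : R := Derive (p_b e_b) rho.

Record barotropic_assumptions (e_b : R -> R) : Prop := BarotropicAssumptions {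
  e_b_C3 : forall rho, 0 < rho ->
    (forall k, (k <= 3)%nat -> ex_derive_n e_b k rho) /\
    continuous (Derive_n e_b 3) rho;
  a_b_sq_ge0 : forall rho, 0 < rho -> 0 <= a_b_sq e_b rho
}.

(** The hat: a function of the density seen as a function of v = 1 / rho. *)
Definition hat (f : R -> R) (v : R) : R := f (/ v).

Definition A_b (e_b : R -> R) (v' v : R) : R :=
  hat e_b v' - hat e_b v
  + / 2 * (hat (p_b e_b) v' + hat (p_b e_b) v) * (v' - v).

(* Main.v *)
Require Import Defs.
From Stdlib Require Import Reals Lra Lia.
From Coquelicot Require Import Coquelicot.
Open Scope R_scope.

(** The function [v |-> e_h v ps + (ps + pL) v / 2] has slope at least
    [pinf + (ps + pL) / 2 > 0], and its increment from [vs] to [vt] is [A_b vs vL],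
    which gives the ordering of [vs] and [vt].  For the quantitative bound,
    [A_b vs vL] is the error of the trapezoidal rule for the integral of the
    non-increasing [p_b] over [[vs, vL]], so it is at least
    [- (p_b vs - p_b vL) (vL - vs) / 2], while [pL > - pinf] makes the slope above at
    least [(ps - pL) / 2]. *)

Lemma increment_ge (f : R -> R) (m a b : R) :
  a <= b ->
  (forall x, a <= x <= b -> ex_derive f x /\ m <= Derive f x) ->
  m * (b - a) <= f b - f a.
Proof.
intros hab hf.
destruct (MVT_gen f a b (Derive f)) as [c [hc ->]];
  rewrite ?Rmin_left, ?Rmax_right in * by lra.
- intros x hx; apply Derive_correct, hf; lra.
- intros x hx.
  apply continuity_pt_filterlim, (ex_derive_continuous f), hf; lra.
- apply Rmult_le_compat_r; [lra | now apply hf].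
Qed.

Lemma p_b_increasing (e_b : R -> R) (hb : barotropic_assumptions e_b)
  (r1 r2 : R) :
  0 < r1 -> r1 <= r2 -> p_b e_b r1 <= p_b e_b r2.
Proof.
intros h1 h12.
enough (0 * (r2 - r1) <= p_b e_b r2 - p_b e_b r1) by lra.
apply increment_ge; [exact h12 |].
intros x hx; split; [| apply (a_b_sq_ge0 _ hb); lra].
apply (ex_derive_mult (fun r => r ^ 2) (Derive e_b)).
- auto_derive; exact I.
- apply (proj1 (e_b_C3 _ hb x ltac:(lra)) 2%nat); lia.
Qed.

(** Chain rule: the factor [- / v ^ 2] from differentiating [/ v] is minus the [rho ^ 2] in
    [p_b]. *)
Lemma is_derive_hat_e_b (e_b : R -> R) (hb : barotropic_assumptions e_b)
  (v : R) :
  0 < v -> is_derive (hat e_b) v (- hat (p_b e_b) v).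
Proof.
intros hv; unfold hat, p_b.
assert (he : ex_derive e_b (/ v)).
{ apply (proj1 (e_b_C3 _ hb (/ v) (Rinv_0_lt_compat v hv)) 1%nat); lia. }
auto_derive.
- split; [exact he | split; [lra | exact I]].
- rewrite (Derive_ext (fun x => e_b x) e_b) by reflexivity.
  field; lra.
Qed.

(** The energy drop from [v'] to [v] is the integral of the pressure, hence at least the smallest
    pressure, that at [v], times [v - v']; subtracting the trapezoid leaves this bound. *)
Lemma A_b_ge (e_b : R -> R) (hb : barotropic_assumptions e_b) (v' v : R) :
  0 < v' -> v' <= v ->
  - (/ 2 * (hat (p_b e_b) v' - hat (p_b e_b) v) * (v - v')) <= A_b e_b v' v.
Proof.
intros h' hle.
assert (hint : hat (p_b e_b) v * (v - v') <= - hat e_b v - - hat e_b v').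
{ apply (increment_ge (fun w => - hat e_b w)); [exact hle |].
  intros x hx.
  assert (hd : is_derive (fun w => - hat e_b w) x (hat (p_b e_b) x)).
  { rewrite <- (Ropp_involutive (hat (p_b e_b) x)).
    apply (is_derive_opp (hat e_b)), is_derive_hat_e_b; [exact hb | lra]. }
  split; [eexists; exact hd |].
  replace (Derive _ x) with (hat (p_b e_b) x)
    by (symmetry; apply is_derive_unique, hd).
  apply (p_b_increasing _ hb).
  - apply Rinv_0_lt_compat; lra.
  - apply Rinv_le_contravar; lra. }
unfold A_b; lra.
Qed.

Theorem lemma3p8 (pinf q : R) (H : complete_eos pinf) (e_b : R -> R)
  (hH : hydro_assumptions q H) (hb : barotropic_assumptions e_b)
  (vL pL ps vs vt : R)
  (hvL : 0 < vL) (hpL : - pinf < pL) (hps : pL <= ps)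
  (hvs0 : 0 < vs) (hvs : vs < vL)
  (RH : e_h H vs ps - e_h H vL pL + / 2 * (ps + pL) * (vs - vL)
        + A_b e_b vs vL = 0)
  (hvt0 : 0 < vt)
  (RHt : e_h H vt ps - e_h H vL pL + / 2 * (ps + pL) * (vt - vL) = 0) :
  (0 <= A_b e_b vs vL -> vs <= vt) /\
  (A_b e_b vs vL <= 0 -> vt <= vs) /\
  (0 <= A_b e_b vs vL -> (vL - vt) / (vL - vs) <= 1) /\
  (A_b e_b vs vL <= 0 -> pL < ps ->
   (vL - vt) / (vL - vs)
     <= 1 + (hat (p_b e_b) vs - hat (p_b e_b) vL) / (ps - pL)).
Proof.
assert (hslope : forall a b, 0 < a -> a <= b ->
  pinf * (b - a) <= e_h H b ps - e_h H a ps).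
{ intros a b ha hab.
  apply (increment_ge (fun w => e_h H w ps)); [exact hab |].
  intros x hx; apply (e_h_dv _ _ hH); lra. }
assert (hge : 0 <= A_b e_b vs vL -> vs <= vt).
{ intros hA.
  destruct (Rle_or_lt vs vt) as [hle | hlt]; [exact hle | exfalso].
  (* [RH] minus [RHt] makes the increment from [vt] to [vs] equal to [- A_b e_b vs vL <= 0], yet its
     slope is positive since [pL] and [ps] exceed [- pinf]. *)
  assert (hs := hslope vt vs hvt0 (Rlt_le _ _ hlt)).
  nra. }
assert (hle : A_b e_b vs vL <= 0 -> vt <= vs).
{ intros hA.
  destruct (Rle_or_lt vt vs) as [hle | hlt]; [exact hle | exfalso].
  assert (hs := hslope vs vt hvs0 (Rlt_le _ _ hlt)).
  nra. }
split; [exact hge | split; [exact hle | split]].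
- intros hA; specialize (hge hA).
  apply Rle_div_l; lra.
- intros hA hp; specialize (hle hA).
  assert (hs := hslope vt vs hvt0 hle).
  assert (hAb := A_b_ge e_b hb vs vL hvs0 (Rlt_le _ _ hvs)).
  set (dp := hat (p_b e_b) vs - hat (p_b e_b) vL) in *.
  (* Both sides are doubled: half the left is at most [- A_b e_b vs vL] by [hs] and [pinf > - pL],
     and [hAb] bounds that by half the right. *)
  assert (hkey : (vs - vt) * (ps - pL) <= dp * (vL - vs)) by nra.
  apply Rle_div_l; [lra |].
  (* The goal then follows from [vL - vt = (vL - vs) + (vs - vt)]. *)
  assert (hq : vs - vt <= dp * (vL - vs) / (ps - pL))
    by (apply Rle_div_r; lra).
  unfold Rdiv in *; lra.
Qed.
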